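(* Let $G=(N,A)$ be an influence diagram, and assume that the rooted junction tree $\mathscr{G}=(\mathscr{V},\mathscr{A})$ is a gradual rooted junction tree corresponding to $G$, i.e. satisfies conditions (a), (b), (c) of the context. Let $M\subseteq N$ be nonempty and let $\preccurlyeq$ be a topological order of the nodes $N$. Then the tree $\bar{\mathscr{G}}=(\bar{\mathscr{V}},\bar{\mathscr{A}})$ generated from $\mathscr{G}$ by the RJT modification algorithm described in the context, with inputs $M$ and $\preccurlyeq$, also satisfies conditions (a), (b), (c), i.e. is a gradual rooted junction tree corresponding to $G$.
   Context: **Influence diagram.** An influence diagram is a directed acyclic graph $G=(N,A)$ whose node set $N$ is the union of chance nodes, decision nodes and value nodes. For $j\in N$, $I(j)$ denotes the set of parents of $j$, i.e. the nodes from which there is an arc to $j$. **Gradual rooted junction tree (RJT).** A directed rooted tree $\mathscr{G}=(\mathscr{V},\mathscr{A})$ consisting of clusters $C_j\in\mathscr{V}$ (subsets of $N$), $j\in N$, where each cluster has only one parent, is a gradual rooted junction tree corresponding to $G$ if: (a) (running intersection property) given two clusters $C_i$ and $C_j$, any cluster $C_k$ on the unique undirected path between $C_i$ and $C_j$ satisfies $C_i\cap C_j\subseteq C_k$; (b) each cluster $C_j\in\mathscr{V}$ is the root cluster of exactly one node $j\in N$ (that is, the root of the subgraph induced by the clusters containing node $j$), and all nodes $j\in N$ appear in at least one of the clusters; (c) for each cluster, $I(j)\subseteq C_j$. **Notation.** It is assumed that there exists a topological ordering among the nodes of the RJT $\mathscr{G}$; $\preccurlyeq$ denotes a topological order of the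 nodes $N$, and $\max_{\preccurlyeq}X$ is the node of highest topological order in $X\subseteq N$. In the tree $\mathscr{G}=(\mathscr{V},\mathscr{A})$, $$P(C_1,C_k):=\{C_j\in\mathscr{V} : \exists (C_1,\dots,C_j,\dots,C_k)\text{ with }(C_l,C_{l+1})\in\mathscr{A}\ \forall l\in\{1,\dots,k-1\}\}$$ is the set of clusters contained on any directed path from $C_1$ to $C_k$, including $C_1$ and $C_k$ themselves, and $$F(j):=\{k\in N : P(C_j,C_k)\neq\emptyset\}$$ is the set of nodes whose root cluster can be reached via a directed path starting from $C_j$. Unprimed clusters $C_j$, the arc set $\mathscr{A}$ and the sets $F(j)$ refer to the given tree $\mathscr{G}$. Primed clusters $C'_j$ and the arc set $\bar{\mathscr{A}}$ refer to the tree $\bar{\mathscr{G}}$ being constructed; $P(C'_a,C'_b)$ is the analogous set of clusters on directed paths in $\bar{\mathscr{G}}$. **RJT modification algorithm.** (Purpose: to obtain an RJT with a cluster containing all nodes of $M$.) 1. Require $M\subseteq N$ and a topological order $\preccurlyeq$. 2. Initialize $\bar{\mathscr{G}}=(\bar{\mathscr{V}},\bar{\mathscr{A}})$ equal to $\mathscr{G}$, and denote by $C'_n$ the root cluster of $n\in N$ in $\bar{\mathscr{G}}$. 3. Find $m=\max_{\preccurlyeq}M$. 4. For each $n\in M\setminus\{m\}$ such that $n\notin C_m$, do lines 5–10: 5. If $m\notin F(n)$, do lines 6–9: 6. Find $e=\max_{\preccurlyeq}\{j\in N : n,m\in F(j)\}$. 7. Find $g\in N$ such that $(C_e,C_g)\in\mathscr{A}$,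 $m\in F(g)$, $n\notin F(g)$. 8. Add the nodes of $C'_e\cap C'_g$ to $C'_c$ for every $c$ whose cluster lies in $P(C_e,C_n)$. 9. Remove the arc $(C'_e,C'_g)$ from $\bar{\mathscr{A}}$ and add the arc $(C'_n,C'_g)$ to $\bar{\mathscr{A}}$. 10. (Whether or not lines 6–9 were executed) add $n$ to every cluster $C'_a\in P(C'_n,C'_m)$. 11. After the loop, return $\bar{\mathscr{G}}$.
   Formalization: Only runs in which the arc (C'_e,C'_g) removed in line 9 is still present in the current tree are covered; if two nodes n select the same arc (C_e,C_g) of the given tree, C'_g would get two parents and the claim would fail. *)

(* Defs.v *)
From mathcomp Require Import all_boot.

Set Implicit Arguments.
Unset Strict Implicit.
Unset Printing Implicit Defensive.

Record influence_diagram (N : finType) := InfluenceDiagram {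
  chance_nodes : {set N};
  decision_nodes : {set N};
  value_nodes : {set N};
  id_arc : rel N;
  nodes_cover : chance_nodes :|: decision_nodes :|: value_nodes = [set: N];
  id_acyclic : forall i j, id_arc i j -> ~~ connect id_arc j i
}.

Definition parents (N : finType) (G : influence_diagram N) (j : N) : {set N} :=
  [set i | id_arc G i j].

(* The clusters are indexed by the nodes: the vertex [j : N] of the tree is the
   cluster C_j, [cluster T j] is its current content as a subset of N, and
   [(i, j) \in arcs T] is the arc (C_i, C_j).  A vertex keeps its name when
   nodes are added to its content.  That C_j is the root cluster of j and of no
   other node is condition (b), not part of this record. *)
Record cluster_tree (N : finType) := ClusterTree {
  cluster : {ffun N -> {set N}};
  arcs : {set N * N}
}.

Section Trees.
Variables (N : finType) (T : cluster_tree N).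

Definition arc : rel N := [rel i j | (i, j) \in arcs T].

Definition uarc : rel N := [rel i j | arc i j || arc j i].

Definition rooted_tree : Prop :=
  exists r : N,
    [/\ forall j, connect arc r j,
        forall j, ~~ arc j r
      & forall i j k, arc i k -> arc j k -> i = j].

(* [r] is the root of the subgraph induced by the vertex set [S]. *)
Definition induced_root (S : {set N}) (r : N) : Prop :=
  r \in S /\
  {in S, forall k, connect [rel x y | [&& x \in S, y \in S & arc x y]] r k}.

Definition clusters_with (j : N) : {set N} := [set k | j \in cluster T k].

(* In a tree the simple undirected path from [i] to [j] is unique. *)
Definition running_intersection : Prop :=
  forall (i j : N) (p : seq N),
    path uarc i p -> last i p = j -> uniq (i :: p) ->
    {in i :: p, forall k, cluster T i :&: cluster T j \subset cluster T k}.

Definition root_clusters : Prop :=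
  (forall i j : N, induced_root (clusters_with j) i <-> j = i) /\
  (forall j : N, exists i : N, j \in cluster T i).

Definition parents_in_cluster (G : influence_diagram N) : Prop :=
  forall j : N, parents G j \subset cluster T j.

Definition gradual_rjt (G : influence_diagram N) : Prop :=
  [/\ rooted_tree,
      running_intersection,
      root_clusters
    & parents_in_cluster G].

(* P(C_a, C_b); see [dipathsP] for the definition by directed paths. *)
Definition dipaths (a b : N) : {set N} :=
  [set j | connect arc a j && connect arc j b].

Lemma dipathsP (a b j : N) :
  reflect (exists p, [/\ path arc a p, last a p = b & j \in a :: p])
          (j \in dipaths a b).
Proof.
rewrite inE; apply: (iffP andP).
  case=> /connectP[p pp jE] /connectP[q pq bE].
  exists (p ++ q); rewrite cat_path last_cat -jE; split=> //.
    by rewrite pp.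
  by rewrite -cat_cons mem_cat jE mem_last.
case=> p [pp <- jp]; case/splitPl: jp pp => p1 p2 <-.
rewrite cat_path last_cat => /andP[pp1 pp2].
by split; apply/connectP; [exists p1 | exists p2].
Qed.

(* F(j) *)
Definition reach (j : N) : {set N} := [set k | dipaths j k != set0].

End Trees.

Definition is_max (N : finType) (le : rel N) (X : {set N}) (x : N) : Prop :=
  x \in X /\ {in X, forall y, le y x}.

Definition topological_order (N : finType) (le : rel N) (e : rel N) : Prop :=
  [/\ reflexive le, antisymmetric le, transitive le, total le
    & forall i j, e i j -> le i j].

(* A topological order of a gradual rooted junction tree is also a topological
   order of the influence diagram (the converse fails). *)
Lemma topological_order_rjt (N : finType) (G : influence_diagram N)
    (T : cluster_tree N) (le : rel N) :
  gradual_rjt T G -> topological_order le (arc T) ->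
  topological_order le (id_arc G).
Proof.
case=> _ _ [rootT _] parT [lexx lean letr letot leT]; split=> // i j ij.
have [_ iroot] : induced_root T (clusters_with T i) i by apply/rootT.
have ji : j \in clusters_with T i.
  by rewrite inE; apply: (subsetP (parT j)); rewrite inE.
case/connectP: (iroot _ ji) => p + ->.
move: (clusters_with T i) => S {iroot ji ij}.
elim: p i => [|y p IHp] k //= /andP[/and3P[_ _ ky] pp].
by apply: letr (leT _ _ ky) (IHp y pp).
Qed.

Section Modification.
Variables (N : finType) (le : rel N).
Implicit Types (T : cluster_tree N) (X S M : {set N}).

Definition add_nodes T X S : cluster_tree N :=
  ClusterTree [ffun c => if c \in S then cluster T c :|: X else cluster T c]
              (arcs T).

Definition move_arc T e g n : cluster_tree N :=
  ClusterTree (cluster T) ((n, g) |: (arcs T :\ (e, g))).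

(* [T0] is the given tree, [T] the current one.  The last premise says that the
   arc (C'_e, C'_g) to be removed is present in the current tree.  It is absent
   when an earlier iteration has already detached C'_g from C'_e, since [e] and
   [g] are computed in [T0]; treating the removal as a no-op would then give
   C'_g a second parent. *)
Inductive reattach (T0 : cluster_tree N) (m n : N) T : cluster_tree N -> Prop :=
  Reattach e g of
      is_max le [set j | (n \in reach T0 j) && (m \in reach T0 j)] e
    & (e, g) \in arcs T0 & m \in reach T0 g & n \notin reach T0 g
    & (e, g) \in arcs T :
    reattach T0 m n T
      (move_arc (add_nodes T (cluster T e :&: cluster T g) (dipaths T0 e n))
                e g n).

Inductive iteration (T0 : cluster_tree N) (m n : N) T : cluster_tree N -> Prop :=
  Iteration T1 of
      (if m \in reach T0 n then T1 = T else reattach T0 m n T T1) :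
    iteration T0 m n T (add_nodes T1 [set n] (dipaths T1 n m)).

Inductive iterations (T0 : cluster_tree N) (m : N) T : seq N -> cluster_tree N -> Prop :=
| IterNil : iterations T0 m T [::] T
| IterCons n s T1 T2 of iteration T0 m n T T1 & iterations T0 m T1 s T2 :
    iterations T0 m T (n :: s) T2.

(* [T] is an output of the algorithm on [T0]; the loop may visit its index set
   in any order. *)
Inductive rjt_modification (T0 : cluster_tree N) M T : Prop :=
  RjtModification m s of
      is_max le M m
    & perm_eq s (enum [set n in M :\ m | n \notin cluster T0 m])
    & iterations T0 m T0 s T.

End Modification.

(* Main.v *)
From mathcomp Require Import all_boot.
Require Import Defs.

Set Implicit Arguments.
Unset Strict Implicit.
Unset Printing Implicit Defensive.

(** In a rooted tree, the running intersection property together with the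
    condition on root clusters is equivalent to a condition on single arcs: [k]
    lies in [C_k], and every [x] in [C_k] other than [k] lies in the cluster of
    the parent of [k].  This local condition is easily checked after each step
    of the algorithm.  The only global fact needed is that the path from [C_e]
    to [C_n] in the original tree survives in the current one; it does because
    the algorithm only ever removes arcs lying above [C_m], and no arc of that
    path does. *)

(** Induction along a path; the step may use that its arc lies between [x] and [y]. *)
Lemma connect_ind (I : finType) (e : rel I) (P : I -> Prop) (x y : I) :
  P x ->
  (forall a b, connect e x a -> connect e b y -> e a b -> P a -> P b) ->
  connect e x y -> P y.
Proof.
move=> Px Pstep /connectP[p pp yE]; move: Pstep; rewrite {y}yE.
elim/last_ind: p pp => [|p z IHp] //.
rewrite rcons_path last_rcons => /andP[pp ez] Pstep.
have xl : connect e x (last x p) by apply/connectP; exists p.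
apply: (Pstep _ _ xl (connect0 _ _) ez).
apply: IHp => // a b xa bp; apply: Pstep => //.
exact: connect_trans bp (connect1 ez).
Qed.

Lemma reachE (N : finType) (T : cluster_tree N) (j k : N) :
  (k \in reach T j) = connect (arc T) j k.
Proof.
rewrite inE; apply/set0Pn/idP => [[i]|jk].
  by rewrite inE => /andP[]; apply: connect_trans.
by exists k; rewrite inE jk connect0.
Qed.

(** Asking for some parent [p] also covers the root, which has none: its cluster can then hold no
    node but its own. *)
Definition parent_closed (N : finType) (T : cluster_tree N) : Prop :=
  forall x k, x \in cluster T k -> x != k ->
    exists2 p, arc T p k & x \in cluster T p.

(** * Ancestors and subtrees in a rooted tree, and the local condition *)

Section RootedTree.
Variables (N : finType) (T : cluster_tree N).
Hypothesis treeT : rooted_tree T.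

Lemma arc_inj i j k : arc T i k -> arc T j k -> i = j.
Proof. by case: treeT => r [_ _]; apply. Qed.

Lemma connect_parent x a b :
  arc T a b -> connect (arc T) x b -> x != b -> connect (arc T) x a.
Proof.
move=> ab /connectP[p]; elim/last_ind: p => [|p z _] /=.
  by move=> _ ->; rewrite eqxx.
rewrite rcons_path last_rcons => /andP[pp az] bz _.
by apply/connectP; exists p => //; apply: arc_inj ab _; rewrite bz.
Qed.

Lemma arc_acyclic a b : arc T a b -> ~~ connect (arc T) b a.
Proof.
(* Induction from the root: a cycle through a vertex goes through its parent. *)
suff nocyc y : forall p, arc T p y -> ~~ connect (arc T) y p by apply: nocyc.
case: (treeT) => r [rT r0 _].
pattern y; apply: (connect_ind _ _ (rT y)) => [p pr|c d _ _ cd IHc p pd].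
  by have := r0 p; rewrite pr.
have -> : p = c by apply: arc_inj pd cd.
apply/negP => dc; have dNc : d != c.
  by apply/eqP => dc'; subst d; have := IHc _ cd; rewrite connect0.
case/connectP: (dc) => q; elim/last_ind: q => [|q z _] /=.
  by move=> _ cE; rewrite cE eqxx in dNc.
rewrite rcons_path last_rcons => /andP[pq qz] cE; rewrite -cE in qz.
have := IHc _ qz; rewrite (connect_trans (connect1 cd)) //.
by apply/connectP; exists q.
Qed.

Lemma connect_anti a b : connect (arc T) a b -> connect (arc T) b a -> a = b.
Proof.
move=> /connectP[[|c p] /= pp ->] // ba; case/andP: pp => ac pp.
suff: connect (arc T) c a by rewrite (negPf (arc_acyclic ac)).
by apply: connect_trans ba; apply/connectP; exists p.
Qed.

(** Climbing from [x] is deterministic, so its ancestors form a chain. *)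
Lemma connect_total a b x :
  connect (arc T) a x -> connect (arc T) b x ->
  connect (arc T) a b \/ connect (arc T) b a.
Proof.
move=> ax; pattern x; apply: (connect_ind _ _ ax) => [|c d ac _ cd IHc bd].
  by right.
have [->|bNd] := eqVneq b d; first by left; apply: connect_trans (connect1 cd).
by apply: IHc; apply: connect_parent bd bNd.
Qed.

(** The only link from the subtree below [x] to the rest is at [x] itself. *)
Lemma connect_uarc_path x b p :
  path (uarc T) b p -> x \notin b :: p -> connect (arc T) x (last b p) ->
  connect (arc T) x b.
Proof.
elim: p b => [|c p IHp] b //= /andP[bc pp].
rewrite inE negb_or => /andP[xNb xp] xl.
have xc := IHp _ pp xp xl; have xNc : x != c.
  by apply: contra xp => /eqP->; rewrite mem_head.
case/orP: bc => bc; first exact: connect_parent xc xNc.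
exact: connect_trans xc (connect1 bc).
Qed.

(** The subtree below [b] can be left only by stepping from [b] to its parent [i]. *)
Lemma uarc_path_below i b y p :
  arc T i b -> connect (arc T) b y -> path (uarc T) y p -> i \notin y :: p ->
  connect (arc T) b (last y p).
Proof.
move=> ib; elim: p y => [|c p IHp] y //= by_ /andP[yc pp].
rewrite inE negb_or => /andP[iNy ip]; apply: IHp => //.
case/orP: yc => yc; first exact: connect_trans by_ (connect1 yc).
have [bE|bNy] := eqVneq b y; last exact: connect_parent by_ bNy.
subst y; rewrite (arc_inj yc ib) in ip.
by rewrite mem_head in ip.
Qed.

Hypothesis closedT : parent_closed T.

(** Climbing from [k], every cluster contains [x] until the vertex [x] is met, at the latest at the
    root. *)
Lemma cluster_connect x k : x \in cluster T k -> connect (arc T) x k.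
Proof.
case: (treeT) => r [rT r0 _].
pattern k; apply: (connect_ind _ _ (rT k)) => [|a b _ _ ab IHa] xk.
- have [->|xNr] := eqVneq x r; first exact: connect0.
  by have [p pr _] := closedT xk xNr; have := r0 p; rewrite pr.
- have [->|xNb] := eqVneq x b; first exact: connect0.
  have [p pb xp] := closedT xk xNb.
  apply: connect_trans (connect1 ab); apply: IHa.
  by rewrite (arc_inj ab pb).
Qed.

Lemma cluster_between x b k :
  x \in cluster T k -> connect (arc T) x b -> connect (arc T) b k ->
  x \in cluster T b.
Proof.
move=> xk xb bk; move: xk.
pattern k; apply: (connect_ind _ _ bk) => // a c ba _ ac IHa xc.
(* Going up from [c] loses [x] only if [x = c], but then the arc from [a] to [c] closes a cycle. *)
have [xE|xNc] := eqVneq x c; last first.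
  by have [p pc xp] := closedT xc xNc; apply: IHa; rewrite (arc_inj ac pc).
subst x; case/negP: (arc_acyclic ac).
exact: connect_trans xb ba.
Qed.

Lemma parent_closed_running_intersection : running_intersection T.
Proof.
move=> i j p pp lp up k kp; apply/subsetP => x /setIP[xi xj].
elim: p i pp lp up kp xi => [|b p IHp] i /=; first by move=> _ _ _ /[!inE] /eqP->.
move=> /andP[ib pp] lp /andP[iNp up]; rewrite in_cons => /orP[/eqP->//|kp] xi.
apply: (IHp b) => //; case/orP: ib => ib.
(* Downward step: the rest of the path avoids [i], so [j] is below [b] and [b] lies between [x] and
   [j]. *)
- apply: cluster_between xj _ _.
    exact: connect_trans (cluster_connect xi) (connect1 ib).
  by rewrite -lp; apply: (uarc_path_below ib _ pp iNp).
(* Upward step: the parent [b] inherits [x] unless [x = i]; then [j] is below [i], which would force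
   [b] below its own child. *)
- have [xE|xNi] := eqVneq x i.
    subst x; case/negP: (arc_acyclic ib).
    by apply: (connect_uarc_path pp iNp); rewrite lp; apply: cluster_connect.
  by have [q qi xq] := closedT xi xNi; rewrite (arc_inj ib qi).
Qed.

Hypothesis selfT : forall k, k \in cluster T k.

Lemma parent_closed_root_clusters : root_clusters T.
Proof.
split=> [i j|j]; last by exists j.
have jroot : induced_root T (clusters_with T j) j.
  split=> [|k]; rewrite inE // => jk.
  have jck := cluster_connect jk.
  move: jk; pattern k; apply: (connect_ind _ _ jck) => [|a b ja _ ab IHa] jb //.
  have jS c : connect (arc T) j c -> connect (arc T) c b ->
      c \in clusters_with T j.
    by move=> jc cb; rewrite inE; apply: cluster_between jb jc cb.
  have aS := jS _ ja (connect1 ab).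
  apply: connect_trans (connect1 _); first by apply: IHa; rewrite inE in aS.
  by rewrite /= aS inE jb.
split=> [[iS iroot]|<- //].
apply: connect_anti; first by apply: cluster_connect; rewrite inE in iS.
case: jroot => jS _; apply: connect_sub (iroot _ jS) => a b /and3P[_ _].
exact: connect1.
Qed.

End RootedTree.

(** The last arc of a path from [x] to [k] inside the clusters containing [x] supplies the
    parent. *)
Lemma root_clusters_parent_closed (N : finType) (T : cluster_tree N) :
  root_clusters T -> parent_closed T.
Proof.
case=> rootT _ x k xk xNk; have [_ xroot] := (rootT x x).2 erefl.
have kS : k \in clusters_with T x by rewrite inE.
case/connectP: (xroot _ kS) => p; elim/last_ind: p => [|p z _] /=.
  by move=> _ kE; rewrite kE eqxx in xNk.
rewrite rcons_path last_rcons => /andP[_ /and3P[pS _ pz]] ->.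
by exists (last x p); rewrite // inE in pS.
Qed.

Lemma root_clusters_self (N : finType) (T : cluster_tree N) k :
  root_clusters T -> k \in cluster T k.
Proof. by case=> rootT _; have [] := (rootT k k).2 erefl; rewrite inE. Qed.

(** Vertices outside the subtree below [g], among them [n], keep their path from the root; the
    subtree is then reached through [n]. *)
Lemma rooted_tree_move_arc (N : finType) (T : cluster_tree N) e g n :
  rooted_tree T -> arc T e g -> ~~ connect (arc T) g n ->
  rooted_tree (move_arc T e g n).
Proof.
move=> treeT eg gn; set T' := move_arc T e g n.
have keep a b : arc T a b -> b != g -> arc T' a b.
  move=> ab bNg; rewrite /arc /= !inE; apply/orP; right.
  by rewrite xpair_eqE (negPf bNg) andbF.
case: (treeT) => r [rT r0 _]; exists r.
have outg j : ~~ connect (arc T) g j -> connect (arc T') r j.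
  pattern j; apply: (connect_ind _ _ (rT j)) => // a b _ _ ab IHa gb.
  have bNg : b != g by apply: contraNneq gb => ->.
  apply: connect_trans (connect1 (keep _ _ ab bNg)); apply: IHa.
  by apply: contra gb => ga; apply: connect_trans ga (connect1 ab).
have rg : connect (arc T') r g.
  by apply: connect_trans (outg n gn) (connect1 _); rewrite /arc /= !inE eqxx.
split=> [j|j|i j k].
- have [gj|] := boolP (connect (arc T) g j); last exact: outg.
  pattern j; apply: (connect_ind _ _ gj) => // a b ga _ ab ra.
  apply: connect_trans ra (connect1 (keep _ _ ab _)).
  by apply/eqP => bE; subst b; case/negP: (arc_acyclic treeT ab).
- rewrite /arc /= !inE negb_or negb_and r0 orbT andbT xpair_eqE.
  by apply/andP => -[_ /eqP rE]; have := r0 e; rewrite rE eg.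
- rewrite /arc /= !inE !xpair_eqE.
  have [->|kNg] := eqVneq k g; last first.
    by rewrite !andbF /=; apply: arc_inj.
  rewrite !andbT.
  have old l : (l, g) \in arcs T -> l = e by move=> lg; apply: arc_inj lg eg.
  by case/orP=> [/eqP->|/andP[/eqP+ /old]] // /orP[/eqP->|/andP[/eqP+ /old]].
Qed.

(** * Invariant of the algorithm and its preservation *)

Section Iterations.
Variables (N : finType) (le : rel N) (T0 : cluster_tree N) (m : N).
Hypothesis treeT0 : rooted_tree T0.

(** [inv_sub] carries condition (c) along; [inv_arc] keeps the path from [e] to [n] available in
    later iterations. *)
Record invariant (T : cluster_tree N) : Prop := Invariant {
  inv_tree : rooted_tree T;
  inv_self : forall k, k \in cluster T k;
  inv_closed : parent_closed T;
  inv_sub : forall k, cluster T0 k \subset cluster T k;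
  inv_arc : forall a b, arc T0 a b -> m \notin reach T0 b -> arc T a b
}.

Lemma sub_add_nodes (T : cluster_tree N) X S k :
  cluster T k \subset cluster (add_nodes T X S) k.
Proof. by rewrite ffunE; case: ifP => // _; apply: subsetUl. Qed.

Lemma invariant_reattach n T T' :
  invariant T -> reattach le T0 m n T T' -> invariant T'.
Proof.
case=> treeT selfT closedT subT arcT [e g [+ _] eg0 mg ng eg].
rewrite in_set !reachE in mg ng * => /andP[en _].
have onpath a b : connect (arc T0) e a -> connect (arc T0) b n ->
    arc T0 a b -> arc T a b /\ b != g.
  move=> ea bn ab.
  have gNb : ~~ connect (arc T0) g b.
    by apply: contra ng => gb; apply: connect_trans gb bn.
  split; last by apply: contraNneq gNb => ->.
  (* Were [b] above [m], it would be comparable with [g]: [g] above [b] puts [g] above [n], and [b]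
     strictly above [g] puts [b] above [e], closing a cycle. *)
  apply: arcT => //; rewrite reachE; apply/negP => mb.
  case: (connect_total treeT0 mg mb) => [gb|bg]; first by rewrite gb in gNb.
  case/negP: (arc_acyclic treeT0 ab); apply: connect_trans ea.
  apply: connect_parent eg0 bg _ => //.
  by apply: contraNneq gNb => ->.
(* Descend from [e], which is not below [g]: a vertex other than [g] is below [g] only if its parent
   is. *)
have gNn : ~~ connect (arc T) g n.
  pattern n; apply: (connect_ind _ _ en) => [|a b ea bn ab ga].
    exact: arc_acyclic.
  have [abT bNg] := onpath _ _ ea bn ab.
  apply: contra ga => gb; apply: connect_parent abT gb _ => //.
  by rewrite eq_sym.
split.
- exact: rooted_tree_move_arc.
- by move=> k; apply: (subsetP (sub_add_nodes _ _ _ _)).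
- move=> x k; set X := _ :&: _; set D := dipaths T0 e n.
  have sub c : x \in cluster T c -> x \in cluster (add_nodes T X D) c.
    exact: (subsetP (sub_add_nodes _ _ _ _)).
  have keep a b : arc T a b -> b != g ->
      arc (move_arc (add_nodes T X D) e g n) a b.
    move=> ab bNg; rewrite /arc /= !inE; apply/orP; right.
    by rewrite xpair_eqE (negPf bNg) andbF.
  have inD c : x \in X -> c \in D -> x \in cluster (add_nodes T X D) c.
    by move=> xX cD; rewrite ffunE cD inE xX orbT.
  have [xk _ xNk|xNk] := boolP (x \in cluster T k).
    (* The old parent still serves unless [k = g]; the new parent [n] of [g] has received the
       intersection of the clusters of [e] and [g]. *)
    have [p pk xp] := closedT _ _ xk xNk; have [kE|kNg] := eqVneq k g.
      subst k; exists n; first by rewrite /arc /= !inE eqxx.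
      apply: inD; last by rewrite inE en connect0.
      by rewrite inE xk andbT -(arc_inj treeT pk eg).
    by exists p; [apply: keep | apply: sub].
  rewrite ffunE; case: ifP => [kD|_ xk]; last by rewrite xk in xNk.
  rewrite inE (negPf xNk) => /= xX _.
  move: (kD); rewrite inE => /andP[ek kn].
  (* Added nodes were already in the cluster of [e], so [k] is not [e] and its parent on the path
     receives them too. *)
  have eNk : e != k by apply: contraNneq xNk => <-; case/setIP: xX.
  case/connectP: (ek) => p; elim/last_ind: p => [|p z _] /=.
    by move=> _ kE; rewrite kE eqxx in eNk.
  rewrite rcons_path last_rcons => /andP[pp pz] kE; rewrite -kE in pz.
  have el : connect (arc T0) e (last e p) by apply/connectP; exists p.
  have [pkT kNg] := onpath _ _ el kn pz.
  exists (last e p); first exact: keep.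
  by apply: inD; rewrite // inE el (connect_trans (connect1 pz)).
- move=> k; apply: subset_trans (subT k) (sub_add_nodes _ _ _ _).
- move=> a b ab mb; rewrite /arc /= !inE.
  have := arcT _ _ ab mb; rewrite /arc /= => ->.
  rewrite andbT !xpair_eqE; apply/orP; right; apply: contra mb => /andP[_ /eqP->].
  by rewrite reachE.
Qed.

Lemma invariant_add_nodes n T :
  invariant T -> invariant (add_nodes T [set n] (dipaths T n m)).
Proof.
case=> treeT selfT closedT subT arcT; split=> //.
- by move=> k; apply: (subsetP (sub_add_nodes _ _ _ _)).
- move=> x k; have [xk _ xNk|xNk] := boolP (x \in cluster T k).
    have [p pk xp] := closedT _ _ xk xNk; exists p => //.
    exact: (subsetP (sub_add_nodes _ _ _ _)).
  rewrite ffunE; case: ifP => [|_ xk]; last by rewrite xk in xNk.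
  rewrite !inE (negPf xNk) => /andP[nk km] /eqP-> nNk.
  (* As [k] is not [n], its parent also lies between [n] and [m] and receives [n]. *)
  case/connectP: (nk) => p; elim/last_ind: p => [|p z _] /=.
    by move=> _ kE; rewrite kE eqxx in nNk.
  rewrite rcons_path last_rcons => /andP[pp pz] kE; rewrite -kE in pz.
  have nl : connect (arc T) n (last n p) by apply/connectP; exists p.
  exists (last n p) => //; rewrite ffunE !inE nl (connect_trans (connect1 pz)) //.
  by rewrite !inE eqxx orbT.
- by move=> k; apply: subset_trans (subT k) (sub_add_nodes _ _ _ _).
Qed.

Lemma invariant_iterations T s T' :
  invariant T -> iterations le T0 m T s T' -> invariant T'.
Proof.
move=> + run; elim: run => {T s T'} // T n s _ T2 [T1 step] _ IH invT.
apply/IH/invariant_add_nodes; case: ifP step => [_ -> //|_].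
exact: invariant_reattach.
Qed.

End Iterations.

Theorem proposition3p3 (N : finType) (G : influence_diagram N)
    (T : cluster_tree N) (M : {set N}) (le : rel N) :
  gradual_rjt T G ->
  M != set0 ->
  topological_order le (id_arc G) ->
  forall T' : cluster_tree N, rjt_modification le T M T' -> gradual_rjt T' G.
Proof.
case=> treeT _ rootT parT _ _ T' [m s _ _ run].
have inv0 : invariant T m T.
  split=> //; first by move=> k; apply: root_clusters_self.
  exact: root_clusters_parent_closed.
have [treeT' selfT' closedT' subT' _] := invariant_iterations treeT inv0 run.
split=> //.
- exact: parent_closed_running_intersection.
- exact: parent_closed_root_clusters.
- by move=> j; apply: subset_trans (parT j) (subT' j).
Qed.
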